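(* Let $G$ be a connected claw-free graph and let $k$ be a non-negative integer. If $\sigma^{4}_{k+3}(G)\geqslant |G|-2k-5$, then $G$ has a spanning tree $T$ such that $\mathrm{Stem}(T)$ has at most $k$ branch vertices.
   Context: All graphs are finite and simple (no loops, no multiple edges). $|G|$ denotes the number of vertices of $G$, $\deg_G(v)$ the degree of $v$ in $G$, and $d_G(u,v)$ the distance between $u$ and $v$ in $G$. A graph is claw-free if it has no induced subgraph isomorphic to $K_{1,3}$. For an integer $l\geqslant 2$, $\alpha^{l}(G)=\max\{|S| : S\subset V(G),\ d_G(x,y)\geqslant l \text{ for all distinct } x,y\in S\}$. For integers $l\geqslant 2$ and $m\geqslant 2$, $$\sigma^{l}_{m}(G)=\min\Big\{\sum_{a\in S}\deg_G(a) : S\subset V(G),\ |S|=m,\ d_G(x,y)\geqslant l \text{ for all distinct } x,y\in S\Big\},$$ with the convention $\sigma^{l}_{m}(G)=+\infty$ if $\alpha^{l}(G)<m$. For a tree $T$, a leaf is a vertex of degree one in $T$, and $\mathrm{Leaf}(T)$ is the set of leaves of $T$. A branch vertex of a tree is a vertex of degree at least three in that tree. The stem of $T$ is the subtree $\mathrm{Stem}(T)=T-\mathrm{Leaf}(T)$ obtained by deleting all leaves of $T$; the branch vertices of $\mathrm{Stem}(T)$ are the vertices whose degree in $\mathrm{Stem}(T)$ is at least three. *)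

(* Defs.v *)
From mathcomp Require Import all_boot all_order all_algebra.
From mathcomp Require Import constructive_ereal.

Set Implicit Arguments.
Unset Strict Implicit.
Unset Printing Implicit Defensive.

Record sgraph (V : finType) := SGraph {
  edge :> rel V;
  edge_sym : symmetric edge;
  edge_irr : irreflexive edge }.

Definition deg (V : finType) (G : sgraph V) (v : V) : nat :=
  #|[set w | G v w]|.

(* The graph with no vertices is not connected. *)
Definition connected (V : finType) (G : sgraph V) : Prop :=
  0 < #|V| /\ forall x y : V, connect G x y.

Definition induced_edge (V : finType) (G : sgraph V) (A : {set V}) :
  rel {x : V | x \in A} := fun x y => G (val x) (val y).

Lemma induced_sym (V : finType) (G : sgraph V) (A : {set V}) :
  symmetric (induced_edge G (A := A)).
Proof. by move=> x y; apply: edge_sym. Qed.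

Lemma induced_irr (V : finType) (G : sgraph V) (A : {set V}) :
  irreflexive (induced_edge G (A := A)).
Proof. by move=> x; apply: edge_irr. Qed.

Definition induced (V : finType) (G : sgraph V) (A : {set V}) :
  sgraph {x : V | x \in A} :=
  SGraph (induced_sym G (A := A)) (induced_irr G (A := A)).

Definition isomorphic (V W : finType) (G : sgraph V) (H : sgraph W) : Prop :=
  exists2 f : V -> W, bijective f & forall x y, H (f x) (f y) = G x y.

Definition Kbip_edge (m n : nat) : rel ('I_m + 'I_n) := fun x y =>
  match x, y with
  | inl _, inr _ | inr _, inl _ => true
  | _, _ => false
  end.

Lemma Kbip_sym (m n : nat) : symmetric (@Kbip_edge m n).
Proof. by case=> [x|x] [y|y]. Qed.

Lemma Kbip_irr (m n : nat) : irreflexive (@Kbip_edge m n).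
Proof. by case. Qed.

Definition Kbip (m n : nat) : sgraph ('I_m + 'I_n)%type :=
  SGraph (@Kbip_sym m n) (@Kbip_irr m n).

Definition claw_free (V : finType) (G : sgraph V) : Prop :=
  ~ exists A : {set V}, isomorphic (induced G A) (Kbip 1 3).

(* [x :: p] is a path of G, without repeated vertices, from x to y; it has
   [size p] edges, hence fewer than #|V|. *)
Definition is_path (V : finType) (G : sgraph V) (x y : V) (p : seq V) : bool :=
  [&& path G x p, last x p == y & uniq (x :: p)].

(* Length of a shortest path, +oo if there is none. *)
Definition dist (V : finType) (G : sgraph V) (x y : V) : \bar int :=
  (\big[Order.min/+oo]_(n < #|V| | [exists p : n.-tuple V, is_path G x y p])
     (n%:Z)%:E)%E.

Definition dist_set (V : finType) (G : sgraph V) (l : nat) (S : {set V}) :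
  bool :=
  [forall x in S, forall y in S, (x != y) ==> ((l%:Z)%:E <= dist G x y)%E].

Definition alpha (V : finType) (G : sgraph V) (l : nat) : nat :=
  \max_(S : {set V} | dist_set G l S) #|S|.

Definition sigma (V : finType) (G : sgraph V) (l m : nat) : \bar int :=
  if (alpha G l < m)%N then +oo%E
  else (\big[Order.min/+oo]_(S : {set V} | (#|S| == m) && dist_set G l S)
          ((\sum_(a in S) deg G a)%N%:Z)%:E)%E.

(* [ucycle] also accepts sequences of one or two vertices; the cycles of a
   simple graph have at least three. *)
Definition acyclic (V : finType) (G : sgraph V) : Prop :=
  forall c : seq V, ucycle G c -> size c < 3.

Definition is_tree (V : finType) (T : sgraph V) : Prop :=
  connected T /\ acyclic T.

Definition spanning_tree (V : finType) (G T : sgraph V) : Prop :=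
  is_tree T /\ subrel T G.

Definition Leaf (V : finType) (T : sgraph V) : {set V} :=
  [set v | deg T v == 1].

Definition Stem (V : finType) (T : sgraph V) :
  sgraph {x : V | x \in ~: Leaf T} := induced T (~: Leaf T).

Definition branch (V : finType) (T : sgraph V) : {set V} :=
  [set v | 3 <= deg T v].

(* Main.v *)
Require Import Defs.
From mathcomp Require Import all_boot all_order all_algebra.
From mathcomp Require Import constructive_ereal zify.

Import Order.TTheory.

Set Implicit Arguments.
Unset Strict Implicit.
Unset Printing Implicit Defensive.

(** Deleting the leaves of a spanning tree leaves a dominating subtree, and
    conversely a dominating subtree becomes a spanning tree once every other
    vertex is hung on it as a pendant; so the goal is a connected subgraph [E]
    of [G], dominating all vertices, with at most [k] branch vertices.  What is
    controlled is the excess of [E], the sum of the numbers deg - 2 over its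
    vertices of degree at least two: it bounds the number of branch vertices,
    it never grows when edges are deleted, and a tree has excess + 2 leaves.

    Among the connected subgraphs of excess at most [k], take [E] dominating as
    many vertices as possible and, subject to this, with as few vertices as
    possible; it can be taken sparse, as a tree.  Suppose that [v] is not
    dominated, and let [w] be a neighbour of [v] that is adjacent to a vertex
    [s] of [E].  Adding the pendant edge [s w] gives a subgraph [P] that
    dominates [v] too.  By maximality every connected subgraph covering the
    vertices of [P] has excess more than [k]; hence [P] has excess exactly
    [k + 1], the vertex [s] has degree at least three in [P], there are at least
    [k + 3] leaves, and no rearrangement can lower the excess of [P].

    - Two leaves of [P] are never joined by a path of [G] that avoids the inner
      vertices of [P]: such a path would close a cycle through a branch vertex,
      and deleting a cycle edge there would lower the excess ([exchange],
      [close_leaves], [leaves_apart]).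
    - Each leaf [x] other than [w] dominates a private vertex, since it could be
      deleted otherwise ([private_nb]); [w] has [v].  The closed neighbourhoods
      of these witnesses avoid the inner vertices, so they lie in different
      components of [G] minus the inner vertices and the witnesses are pairwise
      at distance at least four ([witness_dist]).
    - The vertex [s] is adjacent to the closed neighbourhood of the witness of
      no leaf but [w]: a claw centred at [s] would give an edge that reroutes
      [P] ([no_touch]).  Claw-freeness also shows that, along an edge between
      inner vertices, at most one new neighbourhood is met.  Walking through
      the connected set of inner vertices from [s], all the leaves are reached,
      so there are at least as many inner vertices as leaves
      ([leaves_le_inner]).

    Thus [k + 3] of the witnesses have disjoint closed neighbourhoods that miss
    at least [k + 3] vertices, so their degree sum is at most
    [|G| - 2 (k + 3)], which is less than [|G| - 2 k - 5]: a contradiction. *)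

(** * Edge sets, degrees and excess *)
Section Edges.
Variable V : finType.
Implicit Types (E F : {set V * V}) (A : {set V}) (u v x : V).

(** A subgraph is encoded by its edge set alone, each edge being listed in both
    directions, so that the size of the set is the degree sum.  The vertices are
    the ends of the edges: a subgraph with a single vertex is not represented. *)
Definition erel E : rel V := fun u v => (u, v) \in E.
Definition nb E u : {set V} := [set v | (u, v) \in E].
Definition edeg E u : nat := #|nb E u|.
Definition verts E : {set V} := [set u | 0 < edeg E u].
(** For a tree this is the number of leaves minus two.  Unlike the number of
    leaves, it is monotone in the edge set, so connected subgraphs with cycles can
    be used in place of trees. *)
Definition excess E : nat := \sum_u (edeg E u - 2).
Definition leaves E : {set V} := [set u | edeg E u == 1].
Definition inner E : {set V} := [set u | 1 < edeg E u].
Definition restrict E A : {set V * V} :=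
  [set e in E | (e.1 \in A) && (e.2 \in A)].
Definition add_edge E u v : {set V * V} := (u, v) |: ((v, u) |: E).
Definition del_edge E u v : {set V * V} := E :\ (u, v) :\ (v, u).

Lemma mem_restrict E A u v :
  ((u, v) \in restrict E A) = [&& (u, v) \in E, u \in A & v \in A].
Proof. by rewrite inE. Qed.

Lemma restrict_erel E A u v :
  erel (restrict E A) u v = [&& (u, v) \in E, u \in A & v \in A].
Proof. by rewrite /erel inE /=. Qed.

Lemma mem_add_edge E a b u v :
  ((u, v) \in add_edge E a b) =
  [|| (u == a) && (v == b), (u == b) && (v == a) | (u, v) \in E].
Proof. by rewrite !inE !xpair_eqE. Qed.

Lemma mem_del_edge E a b u v :
  ((u, v) \in del_edge E a b) =
  [&& ~~ ((u == b) && (v == a)), ~~ ((u == a) && (v == b)) & (u, v) \in E].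
Proof. by rewrite !inE !xpair_eqE. Qed.

Lemma vertsP E u : reflect (exists v, (u, v) \in E) (u \in verts E).
Proof.
rewrite inE card_gt0; apply: (iffP (set0Pn _)) => -[v]; first by rewrite inE; exists v.
by move=> uv; exists v; rewrite inE.
Qed.

Lemma mem_verts E u v : (u, v) \in E -> u \in verts E.
Proof. by move=> uv; apply/vertsP; exists v. Qed.

Lemma restrict_sub E A : restrict E A \subset E.
Proof. by apply/subsetP => e; rewrite inE => /andP[]. Qed.

Lemma restrictS E F A : E \subset F -> restrict E A \subset restrict F A.
Proof.
move=> /subsetP EF; apply/subsetP => e; rewrite !inE => /andP[/EF -> ->] //.
Qed.

Lemma connectS E F u v :
  E \subset F -> connect (erel E) u v -> connect (erel F) u v.
Proof.
move=> /subsetP EF; apply: connect_sub => a b ab; apply/connect1/EF/ab.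
Qed.

Lemma vertsS E F : E \subset F -> verts E \subset verts F.
Proof.
move=> /subsetP EF; apply/subsetP => u /vertsP[v uv]; apply/vertsP; exists v.
exact: EF.
Qed.

Lemma edegS E F u : E \subset F -> edeg E u <= edeg F u.
Proof.
by move=> /subsetP EF; apply/subset_leq_card/subsetP => v; rewrite !inE => /EF.
Qed.

Lemma connect_verts E u v : connect (erel E) u v -> u != v -> u \in verts E.
Proof.
case/connectP=> -[|t p] /= ; first by move=> _ ->; rewrite eqxx.
by case/andP=> /mem_verts.
Qed.

Lemma path_restrict E A u p :
  path (erel E) u p -> {subset u :: p <= A} ->
  connect (erel (restrict E A)) u (last u p).
Proof.
elim: p u => [|t p IH] u //= /andP[ut tp] sA.
apply: connect_trans (IH t tp _); last first.
  by move=> y yp; apply: sA; rewrite inE yp orbT.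
apply: connect1; rewrite restrict_erel [(u, t) \in E]ut !sA // !inE eqxx ?orbT //.
Qed.

Lemma edeg_add_le E a b u : edeg (add_edge E a b) u <= edeg E u + (u == a) + (u == b).
Proof.
have sub : nb (add_edge E a b) u \subset
    nb E u :|: ((if u == a then [set b] else set0) :|:
                (if u == b then [set a] else set0)).
  apply/subsetP => v; rewrite !inE !xpair_eqE.
  by case: (u == a); case: (u == b); rewrite !inE /=; do 2?case: (v == _);
     rewrite ?orbT ?orbF //.
apply: leq_trans (subset_leq_card sub) _.
apply: leq_trans (leq_card_setU _ _) _; rewrite -addnA leq_add2l.
apply: leq_trans (leq_card_setU _ _) _.
by case: (u == a); case: (u == b); rewrite ?cards1 ?cards0.
Qed.

Lemma edeg_del_lt E a b : (a, b) \in E -> edeg (del_edge E a b) a < edeg E a.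
Proof.
move=> ab; apply: proper_card; apply/properP; split.
  by apply/subsetP => v; rewrite !inE => /and3P[].
by exists b; rewrite !inE ?ab ?eqxx ?andbF.
Qed.

Lemma del_edge_sub E a b : del_edge E a b \subset E.
Proof. by apply/subsetP => e; rewrite !inE => /and3P[]. Qed.

Lemma add_edge_sub E a b : E \subset add_edge E a b.
Proof. by apply/subsetP => e; rewrite !inE => ->; rewrite !orbT. Qed.

Lemma del_edgeC E a b : del_edge E a b = del_edge E b a.
Proof. by apply/setP => e; rewrite !inE; case: (e == _); case: (e == _). Qed.

Lemma card_edges E : #|E| = \sum_u edeg E u.
Proof.
rewrite -sum1_card (eq_bigl (fun e : V * V => (true && ((e.1, e.2) \in E)))).
  rewrite -(pair_big_dep predT (fun u v => (u, v) \in E) (fun _ _ => 1)) /=.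
  by apply: eq_big => // u _; rewrite sum1_card /edeg cardsE.
by case=> u v.
Qed.

(** Sum over the vertices of the identity (d - 2) + 2 = d + [d = 1], which holds for
    truncated subtraction and all d > 0. *)
Lemma excess_leaves E : excess E + 2 * #|verts E| = #|E| + #|leaves E|.
Proof.
have cE (P : pred V) : #|[set u | P u]| = \sum_u P u.
  by rewrite -sum1dep_card big_mkcond /=; apply: eq_bigr => u _; case: (P u).
rewrite card_edges !cE big_distrr /= -!big_split /=.
by apply: eq_bigr => u _; case: (edeg E u) => [|[|n]] //=; lia.
Qed.

Lemma excess_le E F :
  (forall u, edeg F u - 2 <= edeg E u - 2) -> excess F <= excess E.
Proof. by move=> h; apply: leq_sum => u _; apply: h. Qed.

Lemma excess_lt E F a :
  (forall u, edeg F u - 2 <= edeg E u - 2) -> edeg F a - 2 < edeg E a - 2 ->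
  excess F < excess E.
Proof.
move=> h ha; rewrite /excess (bigD1 a) //= [X in _ < X](bigD1 a) //=.
by rewrite -addSn leq_add // leq_sum.
Qed.

Lemma excess_gt0 E : 0 < excess E -> exists u, 2 < edeg E u.
Proof.
move=> h; apply/existsP; apply: contraLR h => /existsPn h.
rewrite -leqNgt leqn0; apply/eqP/big1 => u _; have := h u; lia.
Qed.

Lemma card_branch_le E : #|[set u | 2 < edeg E u]| <= excess E.
Proof.
rewrite -sum1dep_card big_mkcond /=; apply: leq_sum => u _.
by case: ifP; lia.
Qed.

(** Induction on connected sets, from a vertex [r] and adding one neighbour at a
    time.  It serves both to build spanning trees and to bound the number of
    neighbourhoods that a connected set meets. *)
Lemma connected_ind E A r (P : {set V} -> Prop) :
  r \in A -> {in A, forall u, connect (erel (restrict E A)) r u} ->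
  P [set r] ->
  (forall Y u v, P Y -> Y \subset A -> u \in Y -> v \in A -> v \notin Y ->
     (u, v) \in E -> P (v |: Y)) ->
  P A.
Proof.
move=> rA con P1 Pstep.
suff H n Y : #|A :\: Y| <= n -> r \in Y -> Y \subset A -> P Y -> P A.
  by apply: (H _ [set r]) => //; rewrite ?set11 ?sub1set.
elim: n Y => [|n IH] Y cY rY YA PY; have [AY|] := boolP (A \subset Y).
- by rewrite (_ : A = Y) //; apply/eqP; rewrite eqEsubset AY.
- by rewrite -setD_eq0 -cards_eq0 -leqn0 cY.
- by rewrite (_ : A = Y) //; apply/eqP; rewrite eqEsubset AY.
case/subsetPn=> t tA tY.
suff [u [v [uY vA vY uv]]] :
    exists u v, [/\ u \in Y, v \in A, v \notin Y & (u, v) \in E].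
  apply: (IH (v |: Y)); last exact: (Pstep Y u v).
  - rewrite setUC -setDDl -ltnS; apply: leq_trans cY.
    by rewrite [in X in _ < X](cardsD1 v) !inE vA vY.
  - by rewrite !inE rY orbT.
  - by rewrite subUset sub1set vA.
have /connectP[p] := con t tA.
elim: p (r) rY => [|v p IHp] u uY /=; first by move=> _ E1; rewrite E1 uY in tY.
rewrite restrict_erel -!andbA => /and4P[uv uA vA vp] lp.
have [vY|vY] := boolP (v \in Y); first exact: (IHp v vY vp lp).
by exists u, v.
Qed.

End Edges.

(** * Connected subgraphs and edge exchange *)
Section Subgraphs.
Variables (V : finType) (G : sgraph V).
Implicit Types (E F : {set V * V}) (A : {set V}) (u v x : V).

Record conn_sub E : Prop := ConnSub {
  conn_sub_sym : forall u v, (u, v) \in E -> (v, u) \in E;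
  conn_sub_subgraph : forall u v, (u, v) \in E -> G u v;
  conn_sub_connected : {in verts E &, forall u v, connect (erel E) u v} }.

(** In the extremal argument, dominating all that [E] dominates with a smaller
    excess contradicts maximality, so every rearrangement aims at this. *)
Definition improvable E : Prop :=
  exists F, [/\ conn_sub F, verts E \subset verts F & excess F < excess E].

Lemma restrict_csym E A : (forall u v, (u, v) \in E -> (v, u) \in E) ->
  connect_sym (erel (restrict E A)).
Proof.
move=> sE; apply: sym_connect_sym => u v; rewrite !restrict_erel.
by apply/and3P/and3P=> -[/sE uv uA vA].
Qed.

Lemma restrictT E : restrict E setT = E.
Proof. by apply/setP => e; rewrite !inE !andbT. Qed.

Lemma edges_csym E : (forall u v, (u, v) \in E -> (v, u) \in E) ->
  connect_sym (erel E).
Proof. by move=> sE; rewrite -[E]restrictT; apply: restrict_csym. Qed.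

Lemma conn_sub_root E r :
  (forall u v, (u, v) \in E -> (v, u) \in E) ->
  (forall u v, (u, v) \in E -> G u v) ->
  {in verts E, forall u, connect (erel E) r u} -> conn_sub E.
Proof.
move=> sE subE con; split=> // u v uE vE.
by apply: connect_trans (con v vE); rewrite edges_csym //; apply: con.
Qed.

Lemma add_edge_sym E a b : (forall u v, (u, v) \in E -> (v, u) \in E) ->
  forall u v, (u, v) \in add_edge E a b -> (v, u) \in add_edge E a b.
Proof.
move=> sE u v; rewrite !mem_add_edge => /or3P[/andP[-> ->]|/andP[-> ->]|/sE ->];
by rewrite ?orbT.
Qed.

Lemma add_edge_subgraph E a b : (forall u v, (u, v) \in E -> G u v) -> G a b ->
  forall u v, (u, v) \in add_edge E a b -> G u v.
Proof.
move=> sE ab u v; rewrite mem_add_edge.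
by case/or3P=> [/andP[/eqP-> /eqP->]|/andP[/eqP-> /eqP->]|/sE] //; rewrite edge_sym.
Qed.

Lemma del_edge_sym E a b : (forall u v, (u, v) \in E -> (v, u) \in E) ->
  forall u v, (u, v) \in del_edge E a b -> (v, u) \in del_edge E a b.
Proof.
move=> sE u v; rewrite !mem_del_edge => /and3P[h1 h2 /sE ->].
by rewrite [(v == b) && _]andbC h2 [(v == a) && _]andbC h1.
Qed.

Lemma add_edge_mem1 E a b : (a, b) \in add_edge E a b.
Proof. by rewrite mem_add_edge !eqxx. Qed.
Lemma add_edge_mem2 E a b : (b, a) \in add_edge E a b.
Proof. by rewrite mem_add_edge !eqxx orbT. Qed.

Lemma edeg_add_out E a b u : u != a -> u != b -> edeg (add_edge E a b) u = edeg E u.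
Proof.
move=> ua ub; congr #|pred_of_set _|; apply/setP => v.
by rewrite !inE !xpair_eqE (negPf ua) (negPf ub).
Qed.

Lemma verts_add E a b : verts (add_edge E a b) = a |: (b |: verts E).
Proof.
apply/setP => u; rewrite !in_setU1; apply/vertsP/idP => [[v]|].
  rewrite mem_add_edge => /or3P[/andP[-> _]|/andP[-> _]|/mem_verts ->] //;
  by rewrite ?orbT.
case/or3P=> [/eqP->|/eqP->|/vertsP[v uv]].
- by exists b; apply: add_edge_mem1.
- by exists a; apply: add_edge_mem2.
- by exists v; rewrite mem_add_edge uv !orbT.
Qed.

Lemma conn_sub_pend E a b : conn_sub E -> a \in verts E -> G a b -> conn_sub (add_edge E a b).
Proof.
move=> [sE gE cE] aE ab; apply: (@conn_sub_root _ a).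
- exact: add_edge_sym.
- exact: add_edge_subgraph.
move=> u; rewrite verts_add !in_setU1 => /or3P[/eqP->|/eqP->|uE].
- exact: connect0.
- exact/connect1/add_edge_mem1.
- by apply: connectS (add_edge_sub _ _ _) _; apply: cE.
Qed.

Lemma edeg_out E u : u \notin verts E -> edeg E u = 0.
Proof. by rewrite inE lt0n negbK => /eqP. Qed.

(** Prolonging a subgraph from a leaf costs no excess: the old leaf gets degree
    two and the end of the path is a leaf instead.  The last clause keeps track of
    routes from the new leaf back to [x], which [exchange] asks for. *)
Lemma extend_leaf E x p :
  conn_sub E -> edeg E x = 1 -> path G x p -> uniq p ->
  {in p, forall t, t \notin verts E} ->
  exists F, [/\ conn_sub F, E \subset F, edeg F (last x p) = 1 & excess F <= excess E] /\
    {in verts E, forall u, u != x -> edeg F u = edeg E u /\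
       connect (erel (restrict F (~: [set u]))) (last x p) x}.
Proof.
elim: p E x => [|t p IH] E x cE dx /=.
  by move=> _ _ _; exists E; split; [split|move=> q _ _; split].
move=> /andP[xt tp] /andP[tNp up] out.
have tE : t \notin verts E by apply: out; rewrite mem_head.
have xE : x \in verts E by rewrite inE dx.
have tx : t != x by apply: contraNneq tE => ->.
have dt : edeg (add_edge E x t) t = 1.
  apply/eqP; rewrite eqn_leq.
  have : t \in verts (add_edge E x t) by rewrite verts_add !inE eqxx orbT.
  rewrite inE => ->; rewrite andbT; apply: leq_trans (edeg_add_le _ _ _ _) _.
  by rewrite edeg_out // (negPf tx) eqxx.
have [|F [[cF EF dF exF] conF]] := IH _ t (conn_sub_pend cE xE xt) dt tp up.
  move=> y yp; rewrite verts_add !inE !negb_or.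
  have yE : y \notin verts E by apply: out; rewrite inE yp orbT.
  rewrite inE in yE; rewrite yE andbT.
  rewrite (contraNneq _ yE) /=; last by move->; move: xE; rewrite inE.
  by apply: contraNneq tNp => <-.
have EF' : E \subset F by apply: subset_trans EF; apply: add_edge_sub.
exists F; split; first (split=> //).
  apply: leq_trans exF _; apply: excess_le => u.
  have [->|ux] := eqVneq u x.
    by have := edeg_add_le E x t x; rewrite eqxx eq_sym (negPf tx) dx; lia.
  have [->|ut] := eqVneq u t; first by rewrite dt.
  by rewrite edeg_add_out.
move=> q qE qx; have qt : q != t by apply: contraNneq tE => <-.
have qE1 : q \in verts (add_edge E x t) by rewrite verts_add !in_setU1 qE !orbT.
have [-> tq] := conF q qE1 qt; split; first by rewrite edeg_add_out.
apply: connect_trans tq _.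
apply: connect1; rewrite restrict_erel !inE eq_sym qt eq_sym qx !andbT.
by apply: (subsetP EF); apply: add_edge_mem2.
Qed.

(** The new edge [z q] closes a cycle through [a b], so [a b] can be dropped: the
    two routes, which do not use [a b], connect its ends through [z q].  The leaf
    [z] only gets degree two, the possible gain at [q] is compensated by the loss
    at [b = q] or is harmless as [q] was a leaf, and the branch vertex [a] loses
    one. *)
Lemma exchange E z q a b :
  conn_sub E -> edeg E z = 1 -> q \in verts E -> G z q -> (a, b) \in E -> 2 < edeg E a ->
  connect (erel (restrict E (~: [set b]))) z a ->
  connect (erel (restrict E (~: [set a]))) b q ->
  b = q \/ edeg E q = 1 -> improvable E.
Proof.
move=> cE dz qE zq ab da za bq bORq; have [sE gE conE] := cE.
have zE : z \in verts E by rewrite inE dz.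
have zNq : z != q by apply: contraTneq zq => ->; rewrite edge_irr.
have aNb : a != b by apply: contraTneq (gE _ _ ab) => ->; rewrite edge_irr.
have aNz : a != z by apply: contraTneq da => ->; rewrite dz.
have aNq : a != q.
  by case: bORq => [<-//|dq]; apply: contraTneq da => ->; rewrite dq.
pose F := add_edge (del_edge E a b) z q.
have sF : forall u v, (u, v) \in F -> (v, u) \in F.
  by apply: add_edge_sym; apply: del_edge_sym.
have gF : forall u v, (u, v) \in F -> G u v.
  by apply: add_edge_subgraph => // u v /(subsetP (del_edge_sub _ _ _)); apply: gE.
have restr_b y : y = a \/ y = b -> restrict E (~: [set y]) \subset F.
  move=> yab; apply: subset_trans (add_edge_sub _ _ _).
  apply/subsetP => -[u v]; rewrite mem_del_edge inE /= !inE => /and3P[-> uy vy].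
  rewrite andbT -negb_or.
  by apply/negP => /orP[] /andP[/eqP ? /eqP ?]; subst; case: yab uy vy => ->;
     rewrite eqxx.
have abF : connect (erel F) a b.
  apply: (connect_trans (y := z)).
    by rewrite edges_csym //; apply: connectS za; apply: restr_b; right.
  apply: (connect_trans (y := q)); first exact/connect1/add_edge_mem1.
  by rewrite edges_csym //; apply: connectS bq; apply: restr_b; left.
have conEF u v : connect (erel E) u v -> connect (erel F) u v.
  apply: connect_sub => {}u {}v uv.
  have [uvF|] := boolP ((u, v) \in F); first exact: connect1.
  rewrite mem_add_edge => /norP[_ /norP[_]].
  rewrite mem_del_edge (_ : (u, v) \in E = true) // andbT -negb_or negbK.
  by case/orP=> /andP[/eqP-> /eqP->] //; rewrite edges_csym.
have supEF : verts E \subset verts F.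
  apply/subsetP => u /vertsP[v uv]; apply: (@connect_verts _ _ _ v).
    by apply/conEF/connect1.
  by apply: contraTneq (gE _ _ uv) => ->; rewrite edge_irr.
have leF u := edeg_add_le (del_edge E a b) z q u; rewrite -/F in leF.
have leD u : edeg (del_edge E a b) u <= edeg E u by apply/edegS/del_edge_sub.
have dga : edeg F a < edeg E a by rewrite edeg_add_out // edeg_del_lt.
have dgq : edeg F q <= maxn 2 (edeg E q).
  have := leF q; rewrite eqxx eq_sym (negPf zNq) addn0 addn1 leq_max.
  case: bORq => [bq'|dq] leq; last by rewrite (leq_trans leq) // ltnS -dq leD.
  rewrite orbC (leq_trans leq) //.
  by rewrite -bq' del_edgeC; apply/edeg_del_lt/sE.
have dgz : edeg F z <= 2.
  by have := leF z; rewrite eqxx (negPf zNq) addn0 addn1 => /leq_trans-> //; rewrite ltnS -dz leD.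
have dgu u : u != z -> u != q -> edeg F u <= edeg E u.
  by move=> uz uq; rewrite edeg_add_out.
clearbody F; clear leF leD; exists F; split=> //.
  apply: (@conn_sub_root _ z) => // u uF.
  have [->|uz] := eqVneq u z; first exact: connect0.
  have [uE|uE] := boolP (u \in verts E); first by apply/conEF/conE.
  have uq : u != q by apply: contraNneq uE => ->.
  by move: uF; rewrite inE ltnNge (leq_trans (dgu u uz uq)) // edeg_out.
apply: (@excess_lt _ _ _ a); last exact: ltn_sub2r.
move=> u; have [->|uz] := eqVneq u z.
  by rewrite (_ : edeg F z - 2 = 0) //; apply/eqP; rewrite subn_eq0.
have [->|uq] := eqVneq u q; last by rewrite leq_sub2r ?dgu.
move: dgq; rewrite leq_max => /orP[le2|]; last exact: leq_sub2r.
by rewrite (_ : edeg F q - 2 = 0) //; apply/eqP; rewrite subn_eq0.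
Qed.

End Subgraphs.

(** * Sparse spanning subgraphs and the separation of leaves *)
Lemma ucycle_two_nbs (T : eqType) (e : rel T) (c : seq T) (v : T) :
  ucycle e c -> v \in c -> 2 < size c ->
  exists a b, [/\ a != b, e a v & e v b].
Proof.
move=> /andP[cy uc] vc sc; have [i c' rot_c] := rot_to vc.
move: cy uc sc; rewrite -(rot_cycle i) -(rot_uniq i) -(size_rot i) rot_c.
case: c' {rot_c} => [|b c'] //=; case/lastP: c' => [|c' a] //=.
rewrite rcons_path last_rcons !mem_rcons !inE => /and3P[vb _ av].
case/and3P=> _ /norP[ba _] _ _; exists a, b; split=> //.
by rewrite eq_sym.
Qed.

Section Trees.
Variables (V : finType) (G : sgraph V).
Implicit Types (E F : {set V * V}) (A : {set V}) (u v x : V).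

Definition graph_edges : {set V * V} := [set e | G e.1 e.2].
(** The edges of [G] outside the inner vertices of [E]; leaves of [E] are kept. *)
Definition outer_edges E : {set V * V} := restrict graph_edges (~: inner E).
Definition acyclic_edges E : Prop := forall c, ucycle (erel E) c -> size c < 3.

(** A cycle through [b] would need two neighbours of [b]. *)
Lemma acyclic_edges_pend E a b :
  acyclic_edges E -> b \notin verts E -> a != b ->
  (forall u v, (u, v) \in E -> (v, u) \in E) -> acyclic_edges (add_edge E a b).
Proof.
move=> aE bE ab sE c; have [bc|bc] := boolP (b \in c) => cy.
  rewrite ltnNge; apply/negP => sc.
  have [x [y [xy xb by_]]] := ucycle_two_nbs cy bc sc.
  have nbb t : (b, t) \in add_edge E a b -> t = a.
    rewrite mem_add_edge eq_sym (negPf ab) eqxx /= => /orP[/eqP//|/mem_verts].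
    by rewrite (negPf bE).
  by move: xy; rewrite (nbb y by_) (nbb x) ?eqxx //; apply: add_edge_sym.
apply: aE; case/andP: cy => cy uc; rewrite /ucycle uc andbT.
apply: (sub_in_cycle (P := predC1 b)) cy; last first.
  by apply/allP => t tc; apply: contraNneq bc => <-.
move=> u v ub vb; rewrite /erel mem_add_edge.
by rewrite (negPf ub) (negPf vb) andbF.
Qed.

(** Grow a tree inside [E] by pendant edges; each one adds one vertex and two
    ordered pairs. *)
Lemma sparse_tree E r : conn_sub G E -> r \in verts E ->
  exists T : {set V * V}, [/\ T \subset E, conn_sub G T, verts T = verts E,
                #|T| + 2 <= 2 * #|verts E| & acyclic_edges T].
Proof.
move=> [sE gE' cE] rE.
pose P (Y : {set V}) := exists T : {set V * V},
   [/\ T \subset E, forall u v, (u, v) \in T -> (v, u) \in T,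
     {in Y, forall u, connect (erel T) r u}, verts T \subset Y
     & #|T| + 2 <= 2 * #|Y| /\ acyclic_edges T].
have [T [TE sT cT YT [nT aT]]] : P (verts E).
  apply: (connected_ind (E := E) (r := r)) => //.
  - move=> u uE; rewrite (_ : restrict E _ = E); first exact: cE.
    apply/setP=> -[a b]; rewrite inE /=; case ab: (_ \in E) => //=.
    by rewrite (mem_verts ab) (mem_verts (sE _ _ ab)).
  - exists set0; split; first exact: sub0set.
    + by move=> u v; rewrite inE.
    + by move=> u /set1P->; apply: connect0.
    + by apply/subsetP => u /vertsP[v]; rewrite in_set0.
    + rewrite cards0 cards1; split=> // -[|a [|b [|d c]]] //=.
      by rewrite /ucycle /= /erel inE.
  move=> Y u v [T [TE sT cT YT [nT aT]]] YA uY vA vY uv.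
  have vT : v \notin verts T by apply: contra vY; apply: (subsetP YT).
  have uNv : u != v by apply: contraNneq vY => <-.
  exists (add_edge T u v); split.
  - by rewrite /add_edge !subUset !sub1set uv sE.
  - exact: add_edge_sym.
  - have ru : connect (erel (add_edge T u v)) r u.
      by apply: connectS (cT u uY); apply: add_edge_sub.
    move=> t /setU1P[->|tY]; first by apply: connect_trans ru (connect1 _); apply: add_edge_mem1.
    by apply: connectS (cT t tY); apply: add_edge_sub.
  - rewrite verts_add; apply/subsetP => t; rewrite !in_setU1.
    by case/or3P=> [/eqP->|->|/(subsetP YT) ->] //; rewrite ?uY orbT.
  - split; last exact: acyclic_edges_pend.
    rewrite cardsU1 vY mulnDr [2 * true + _]addnC; apply: leq_trans (leq_add nT (leqnn _)).
    rewrite addnAC leq_add2r /add_edge !cardsU1 addnA [_ + #|T|]addnC leq_add2l.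
    by case: (_ \notin _); case: (_ \notin _).
have cT' : conn_sub G T.
  apply: (@conn_sub_root _ _ _ r) => // [u v /(subsetP TE)/gE'//|u uT].
  by apply: cT; apply: (subsetP YT).
exists T; split=> //; apply/eqP; rewrite eqEsubset YT.
apply/subsetP => u uE; have /vertsP[v uv] := uE.
have uNv : u != v by apply: contraTneq (gE' _ _ uv) => ->; rewrite edge_irr.
apply: (connect_verts (v := v)) => //; apply: (connect_trans (y := r)).
  by rewrite edges_csym //; apply: cT.
by apply: cT; apply/(mem_verts (sE _ _ uv)).
Qed.

(** The neighbours of a vertex of degree at most two on a path are its two
    neighbours along the path, so an edge can only leave the path through the
    vertex [u] that precedes it. *)
Lemma thin_path_closed E u t p :
  (forall u v, (u, v) \in E -> (v, u) \in E) ->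
  path (erel E) t p -> uniq (u :: t :: p) -> (t, u) \in E ->
  {in t :: p, forall y, edeg E y <= 2} -> edeg E (last t p) = 1 ->
  forall y v, y \in t :: p -> (y, v) \in E -> v \in u :: t :: p.
Proof.
move=> sE; elim: p u t => [|t' p IH] u t.
  move=> _ _ tu _ /= /eqP/cards1P[z nt] y v; rewrite inE => /eqP-> tv.
  have : v \in nb E t by rewrite inE.
  have : u \in nb E t by rewrite inE.
  by rewrite nt !inE => /eqP-> /eqP->; rewrite eqxx.
rewrite [path _ _ _]/= => /andP[tt' pt'] /andP[uN U] tu thin dl y v.
rewrite inE => /orP[/eqP->{y} tv|yp yv]; last first.
  rewrite inE; apply/orP; right; apply: (IH t t' pt' _ _ _ _ y) => //.
  - exact: sE.
  - by move=> z zp; apply: thin; rewrite inE zp orbT.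
have ut' : u != t' by apply: contraNneq uN => ->; rewrite !inE eqxx orbT.
have ntE : [set u; t'] = nb E t.
  apply/eqP; rewrite eqEcard; apply/andP; split.
    by apply/subsetP => z; rewrite !inE => /orP[]/eqP->.
  by rewrite cards2 ut'; apply: thin; rewrite mem_head.
have : v \in nb E t by rewrite inE.
by rewrite -ntE !inE => /orP[] ->; rewrite ?orbT.
Qed.

(** A path of [E] from [z] to [q] meets a branch vertex [a], for otherwise the path
    would be the whole of [E], which has positive excess.  Exchange the edge of the
    path that leaves [a] for [z q]. *)
Lemma close_leaves E z q :
  conn_sub G E -> 0 < excess E -> edeg E z = 1 -> edeg E q = 1 -> G z q -> improvable G E.
Proof.
move=> cE ex dz dq zq; have [sE gE' conE] := cE.
have zE : z \in verts E by rewrite inE dz.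
have qE : q \in verts E by rewrite inE dq.
have zNq : z != q by apply: contraTneq zq => ->; rewrite edge_irr.
have /connectP[p0 zp0 lq0] := conE z q zE qE.
case/shortenP: zp0 lq0 => p zp up _ lq.
have [/hasP[a ap da]|/hasPn thin] := boolP (has (fun a => 2 < edeg E a) p); last first.
  exfalso; case: p zp up lq thin => [|t p]; first by move=> _ _ lq; rewrite lq eqxx in zNq.
  rewrite [path _ _ _]/= => /andP[zt tp] up lq thin.
  have [b db] := excess_gt0 ex.
  have bE : b \in verts E by rewrite inE (ltn_trans _ db).
  have clo : forall y v, y \in z :: t :: p -> (y, v) \in E -> v \in z :: t :: p.
    move=> y v; rewrite inE => /orP[/eqP->|]; last first.
      apply: thin_path_closed => //; first exact: sE.
      - by move=> y' /thin; rewrite -leqNgt.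
      - by rewrite -[last t p]/(last z (t :: p)) -lq.
    move=> zv; move/eqP/cards1P: dz => [w nw].
    have : v \in nb E z by rewrite inE.
    have : t \in nb E z by rewrite inE.
    by rewrite nw !inE => /eqP-> /eqP->; rewrite eqxx orbT.
  have stay r : forall s, s \in z :: t :: p -> path (erel E) s r ->
      last s r \in z :: t :: p.
    elim: r => [|y r IH] s sp //= /andP[sy yr].
    by apply: IH => //; apply: clo sy.
  have : b \in z :: t :: p.
    by have /connectP[r zr ->] := conE _ _ zE bE; apply: stay; rewrite ?mem_head.
  rewrite inE => /orP[/eqP E1|/thin]; first by rewrite E1 dz in db.
  by rewrite db.
have aNq : a != q by apply: contraTneq da => ->; rewrite dq.
case/splitPr: ap zp up lq => p1 p2; rewrite cat_path last_cat /=.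
case: p2 => [|b p2]; first by move=> _ _ E1; rewrite E1 eqxx in aNq.
rewrite [path _ _ _]/= => /and3P[zp1 p1a /andP[ab bp2]].
rewrite mem_cat !inE cat_uniq !negb_or => /= U lq.
case/and4P: U => /and4P[zp1N za zb zp2] up1 /and3P[ap1 bp1 _].
case/andP; rewrite inE negb_or => /andP[aNb ap2] _.
apply: (@exchange _ _ E z q a b) => //; last by right.
  rewrite -(last_rcons z p1 a).
  apply: path_restrict; first by rewrite rcons_path zp1.
  move=> y; rewrite inE mem_rcons !inE => /or3P[/eqP->|/eqP->|yp1] //.
  by apply: contraNneq bp1 => <-.
rewrite lq; apply: path_restrict => // y; rewrite !inE => /orP[/eqP->|yp2].
  by rewrite eq_sym.
by apply: contraNneq ap2 => <-.
Qed.

(** On a path that avoids the inner vertices, the first vertex of [E] after [x] is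
    another leaf; extend [E] along the path up to it and close the two leaves. *)
Lemma leaves_apart E x y :
  conn_sub G E -> 0 < excess E -> ~ improvable G E ->
  edeg E x = 1 -> edeg E y = 1 -> x != y -> ~~ connect (erel (outer_edges E)) x y.
Proof.
move=> cE ex stuck dx dy xy; apply/negP => /connectP[p0 xp0 ly0].
case/shortenP: xp0 ly0 => p xp up _ ly {p0}.
have yE : y \in verts E by rewrite inE dy.
have hasp : has (mem (verts E)) p.
  apply/hasP; exists y => //; case: p ly {xp up} => [|t p] ly.
    by rewrite ly eqxx in xy.
  by rewrite ly /= mem_last.
case/split_find: hasp xp up {ly} => q p1 p2 /= qE outp1.
rewrite cat_path => /andP[xp _]; rewrite mem_cat negb_or mem_rcons !inE negb_or.
case/andP=> /andP[/andP[xNq xp1] _]; rewrite cat_uniq rcons_uniq => /andP[/andP[_ up1] _].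
move: xp; rewrite rcons_path => /andP[xp1' lq].
have Gp1 : path G x p1.
  apply: sub_path xp1' => u v; rewrite restrict_erel => /and3P[].
  by rewrite inE.
move: lq; rewrite restrict_erel => /and3P[]; rewrite inE /= => lq _ qI.
have dq : edeg E q = 1 by move: qE qI; rewrite !inE; lia.
have [|F [[cF EF dF exF] con]] := extend_leaf cE dx Gp1 up1.
  by move=> t tp1; apply: contra outp1 => tE; apply/hasP; exists t.
have qx : q != x by rewrite eq_sym.
have [dFq _] := con q qE qx.
have exEF : excess F = excess E.
  apply/eqP; rewrite eqn_leq exF; apply: excess_le => u.
  by apply: leq_sub2r; apply: edegS.
rewrite -dFq in dq; rewrite -exEF in ex.
have [F' [cF' sF' eF']] := close_leaves cF ex dF dq lq.
apply: stuck; exists F'; split=> //; last by rewrite -exEF.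
by apply: subset_trans sF'; apply: vertsS.
Qed.

(** By [leaves_apart], a path that starts at a leaf and avoids the inner vertices
    cannot come back to [E]. *)
Lemma outer_path E x z :
  conn_sub G E -> 0 < excess E -> ~ improvable G E -> edeg E x = 1 ->
  connect (erel (outer_edges E)) x z ->
  exists p, [/\ path G x p, uniq p, {in p, forall t, t \notin verts E} & z = last x p].
Proof.
move=> cE ex stuck dx /connectP[p0 xp0 lz].
case/shortenP: xp0 lz => p xp /andP[xNp up] _ lz {p0}; exists p; split=> //.
  by apply: sub_path xp => u v; rewrite restrict_erel => /and3P[]; rewrite inE.
move=> t tp; apply/negP => tE; case/splitPr: tp xp xNp {lz up} => p1 p2.
rewrite -cat_rcons cat_path mem_cat negb_or mem_rcons inE negb_or.
move=> /andP[xp _] /andP[/andP[xt _] _].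
have tI : t \notin inner E.
  by move: xp; rewrite rcons_path restrict_erel => /andP[_ /and3P[_ _]]; rewrite inE.
have dt : edeg E t = 1 by move: tE tI; rewrite !inE; lia.
have /negP[] := leaves_apart cE ex stuck dx dt xt.
by apply/connectP; exists (rcons p1 t) => //; rewrite last_rcons.
Qed.

End Trees.

(** * Claws at the attachment vertex *)
Section Claw.
Variables (V : finType) (G : sgraph V).
Implicit Types (E F : {set V * V}) (A : {set V}) (u v x : V).

(** Claw-freeness in the form in which it is used: of three neighbours of [s], if
    the first is adjacent to neither of the others, then these two are adjacent. *)
Lemma claw_free_adj s a b c : claw_free G ->
  G s a -> G s b -> G s c -> a != b -> a != c -> b != c ->
  ~~ G a b -> ~~ G a c -> G b c.
Proof.
move=> claw sa sb sc ab ac bc nab nac; apply/negPn/negP => nbc; apply: claw.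
have neq x y : G x y -> x != y by apply: contraTneq => ->; rewrite edge_irr.
have [sNa sNb sNc] := And3 (neq _ _ sa) (neq _ _ sb) (neq _ _ sc).
pose A := [set s; a; b; c]; exists A.
pose f (x : {x : V | x \in A}) : 'I_1 + 'I_3 :=
  if val x == s then inl ord0 else
  if val x == a then inr (@Ordinal 3 0 isT) else
  if val x == b then inr (@Ordinal 3 1 isT) else inr (@Ordinal 3 2 isT).
have memA x : x \in A -> [\/ x = s, x = a, x = b | x = c].
  rewrite !inE -!orbA => /or4P[]/eqP->;
  by [constructor 1 | constructor 2 | constructor 3 | constructor 4].
have [as_ bs cs] : [/\ a == s = false, b == s = false & c == s = false].
  by split; apply: negbTE; rewrite eq_sym.
have [ba [ca cb]] : b == a = false /\ c == a = false /\ c == b = false.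
  by split; [|split]; apply: negbTE; rewrite eq_sym.
have fE := (as_, bs, cs, ba, ca, cb, eqxx).
exists f.
  apply: inj_card_bij.
    move=> [x xA] [y yA]; rewrite /f /= => fxy; apply: val_inj => /=.
    by move: fxy; case: (memA x xA) => ->; case: (memA y yA) => ->; rewrite !fE.
  rewrite card_sum !card_ord card_sig.
  have -> : #|[pred x | x \in A]| = #|A| by apply: eq_card.
  rewrite /A -setUA -setUA !cardsU1 !inE cards1 eq_sym as_.
  by rewrite -[s == b]negbK sNb /= (eq_sym s c) cs (eq_sym a b) ba (eq_sym a c) ca (eq_sym b c) cb.
move=> [x xA] [y yA]; rewrite /= /induced_edge /f /=.
case: (memA x xA) => ->; case: (memA y yA) => ->; rewrite !fE /= ?edge_irr //;
by rewrite ?sa ?sb ?sc ?(negPf nab) ?(negPf nac) ?(negPf nbc) // edge_sym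
  ?sa ?sb ?sc ?(negPf nab) ?(negPf nac) ?(negPf nbc).
Qed.

(** Stop a path from [x] at the first of [q1], [q2], [s] that it meets; from [q1] or
    [q2], step to [s] directly. *)
Lemma avoid_one E s q1 q2 x :
  (forall u v, (u, v) \in E -> (v, u) \in E) ->
  q1 != q2 -> q1 != s -> q2 != s -> (s, q1) \in E -> (s, q2) \in E ->
  connect (erel E) x s ->
  connect (erel (restrict E (~: [set q1]))) x s \/
  connect (erel (restrict E (~: [set q2]))) x s.
Proof.
move=> sE q12 q1s q2s sq1 sq2 /connectP[p].
elim: p x => [|t p IH] x /=; first by move=> _ ->; left; apply: connect0.
move=> /andP[xt tp] ls.
have [->|x1] := eqVneq x q1.
  right; apply: connect1; rewrite restrict_erel !inE sE // q12 /=.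
  by rewrite eq_sym.
have [->|x2] := eqVneq x q2.
  left; apply: connect1; rewrite restrict_erel !inE sE //= eq_sym q12.
  by rewrite eq_sym.
have [t1|t1] := eqVneq t q1.
  right; apply: (connect_trans (y := t)).
    by apply: connect1; rewrite restrict_erel !inE [(x, t) \in E]xt x2 t1 q12.
  apply: connect1; rewrite restrict_erel !inE t1 sE //= q12.
  by rewrite eq_sym.
have [t2|t2] := eqVneq t q2.
  left; apply: (connect_trans (y := t)).
    by apply: connect1; rewrite restrict_erel !inE [(x, t) \in E]xt x1 t1.
  apply: connect1; rewrite restrict_erel !inE t1 t2 sE //=.
  by rewrite eq_sym.
case: (IH t tp ls) => ts; [left|right]; apply: connect_trans ts;
by apply: connect1; rewrite restrict_erel !inE [(x, t) \in E]xt ?x1 ?x2 ?t1 ?t2.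
Qed.

Lemma outer_csym E : connect_sym (erel (outer_edges G E)).
Proof. by apply: restrict_csym => u v; rewrite !inE edge_sym. Qed.

Lemma outer_edge E u v : G u v -> u \notin inner E -> v \notin inner E ->
  connect (erel (outer_edges G E)) u v.
Proof.
by move=> uv uI vI; apply: connect1; rewrite restrict_erel !in_setC uI vI inE /= uv.
Qed.

Lemma leaf_notin_inner E x : edeg E x = 1 -> x \notin inner E.
Proof. by rewrite inE => ->. Qed.

Lemma outer_notin_inner E x z : edeg E x = 1 -> connect (erel (outer_edges G E)) x z ->
  z \notin inner E.
Proof.
move=> dx xz; have [<-|xNz] := eqVneq x z; first exact: leaf_notin_inner.
have : z \in verts (outer_edges G E).
  by apply: (connect_verts (v := x)); rewrite ?[z == x]eq_sym // outer_csym.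
by case/vertsP=> t; rewrite mem_restrict in_setC => /and3P[].
Qed.

(** Choose a neighbour [q] of [s] in [E], other than [w], off some route from [x] to
    [s].  If [s] and [z] were adjacent, consider [w], [q], [z] around [s].  The pair
    [w z] is not an edge, as [w] and [x] are separated; [w q] is not an edge, since
    it could replace [s q]; so [q z] is an edge, and [E] prolonged from [x] to [z]
    improves by exchanging [s q] for [z q]. *)
Lemma no_touch E s w x z :
  claw_free G -> conn_sub G E -> 0 < excess E -> ~ improvable G E ->
  (s, w) \in E -> edeg E w = 1 -> 2 < edeg E s -> edeg E x = 1 -> x != w ->
  connect (erel (outer_edges G E)) x z -> ~~ G s z.
Proof.
move=> claw cE ex stuck sw dw ds dx xw xz; apply/negP => sz.
have [sE gE' conE] := cE.
have irr u v : (u, v) \in E -> u != v.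
  by move/gE'; apply: contraTneq => ->; rewrite edge_irr.
have xE : x \in verts E by rewrite inE dx.
have sE' : s \in verts E by apply: mem_verts sw.
have xs : x != s by apply: contraTneq ds => <-; rewrite dx.
(* Of the two neighbours of [s] other than [w], one is avoided by a route to [x]. *)
have [q [sq qw xsq]] : exists q, [/\ (s, q) \in E, q != w
    & connect (erel (restrict E (~: [set q]))) x s].
  have : 1 < #|nb E s :\ w|.
    by move: ds; rewrite /edeg (cardsD1 w) inE sw; lia.
  case/card_gt1P=> q1 [q2 []]; rewrite !inE => /andP[q1w sq1] /andP[q2w sq2] q12.
  have [] := avoid_one sE q12 _ _ sq1 sq2 (conE _ _ xE sE').
  - by rewrite eq_sym irr.
  - by rewrite eq_sym irr.
  - by exists q1.
  - by exists q2.
have qE : q \in verts E by apply: mem_verts (sE _ _ sq).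
have qs : q != s by rewrite eq_sym irr.
have qx : q != x.
  apply/eqP => qx; have /vertsP[t] := connect_verts xsq xs.
  by rewrite mem_restrict !inE qx eqxx andbF.
(* Otherwise [w q] replaces [s q], the other route being the edge [w s]. *)
have nwq : ~~ G w q.
  apply/negP => wq; apply: stuck.
  apply: (@exchange _ _ E w q s q) => //; last by left.
  apply: connect1; rewrite restrict_erel !inE sE //= eq_sym qw.
  by rewrite eq_sym.
have xwN := leaves_apart cE ex stuck dx dw xw.
have zI := outer_notin_inner dx xz.
have zw : w != z by apply: contraNneq xwN => ->.
have nwz : ~~ G w z.
  apply: contra xwN => wz; apply: connect_trans xz _; apply: outer_edge => //.
    by rewrite edge_sym.
  exact: leaf_notin_inner.
have [p [xp up outp lz]] := outer_path cE ex stuck dx xz.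
have qz : q != z.
  rewrite lz; case: p {xp up lz} outp => [|t p] outp //=.
  by apply: contraTneq qE => ->; apply: outp; rewrite mem_last.
have qz' : G q z.
  apply: (claw_free_adj (s := s) (a := w)) => //; try exact: gE'.
  by rewrite eq_sym.
have [F [[cF EF dF exF] con]] := extend_leaf cE dx xp up outp.
rewrite -lz in dF con.
have [dFs _] : edeg F s = edeg E s /\ connect (erel (restrict F (~: [set s]))) z x.
  by apply: con; rewrite // eq_sym.
have [_ zx] := con q qE qx.
have [] : improvable G F; last move=> F' [cF' sF' eF'].
  apply: (@exchange _ _ F z q s q) => //; last by left.
  - exact: (subsetP (vertsS EF)).
  - by rewrite edge_sym.
  - exact: (subsetP EF).
  - by rewrite dFs.
  - by apply: connect_trans zx _; apply: connectS xsq; apply: restrictS.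
apply: stuck; exists F'; split=> //; last exact: leq_trans exF.
by apply: subset_trans sF'; apply: vertsS.
Qed.

End Claw.

(** * A distance-four set attached to the leaves *)
Section Certificate.
Variables (V : finType) (G : sgraph V).
Implicit Types (E F : {set V * V}) (A : {set V}) (u v x : V).

(** Two adjacent vertices of degree one would form the whole subgraph. *)
Lemma leaf_nb_inner E s t t' : conn_sub G E -> s \in inner E ->
  (t, t') \in E -> t \notin inner E -> t' \in inner E.
Proof.
move=> [sE gE' cE] sI tt' tI; apply/negPn/negP => t'I.
have only u v w : u \notin inner E -> (u, v) \in E -> (u, w) \in E -> w = v.
  rewrite inE -leqNgt => /card_le1_eqP uI uv uw.
  by apply: (uI v w); rewrite inE.
have sNt : s \notin [set t; t'].
  by rewrite !inE; apply/norP; split; [apply: contraNneq tI | apply: contraNneq t'I] => <-.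
have sS : s \in verts E by move: sI; rewrite !inE => /ltnW.
have /(closed_connect _) := cE t s (mem_verts tt') sS.
have cl : closed (erel E) [set t; t'].
  apply: intro_closed; first exact: edges_csym.
  move=> u v uv /set2P[E1|E1]; rewrite E1 in uv.
    by rewrite (only _ _ _ tI tt' uv) !inE eqxx orbT.
  by rewrite (only _ _ _ t'I (sE _ _ tt') uv) !inE eqxx.
by move=> /(_ _ cl); rewrite (negPf sNt) !inE eqxx.
Qed.

(** Retract each leaf to its neighbour, which is inner: an edge is sent to an edge
    between inner vertices or to a single vertex. *)
Lemma inner_connected E s : conn_sub G E -> s \in inner E ->
  {in inner E, forall u, connect (erel (restrict E (inner E))) s u}.
Proof.
move=> cE sI u uI; have [sE gE' conE] := cE.
pose f t := if t \in inner E then t else odflt t [pick t' | (t, t') \in E].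
have fI t : t \in inner E -> f t = t by rewrite /f => ->.
have fL t t' : t \notin inner E -> (t, t') \in E -> f t = t'.
  move=> tI tt'; rewrite /f (negPf tI); case: pickP => [y ty /=|/(_ t')]; last by rewrite tt'.
  by move: tI; rewrite inE -leqNgt => /card_le1_eqP; apply; rewrite inE.
have hom t t' : (t, t') \in E ->
    connect (erel (restrict E (inner E))) (f t) (f t').
  move=> tt'; have [tI|tI] := boolP (t \in inner E); last first.
    by rewrite (fL _ _ tI tt') fI // (leaf_nb_inner cE sI tt').
  have [t'I|t'I] := boolP (t' \in inner E); last by rewrite (fL _ _ t'I (sE _ _ tt')) fI.
  by rewrite !fI //; apply: connect1; rewrite restrict_erel tt' tI.
have inS t : t \in inner E -> t \in verts E by rewrite !inE => /ltnW.
rewrite -(fI s sI) -(fI u uI).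
case/connectP: (conE s u (inS _ sI) (inS _ uI)) => p sp ->.
elim: p (s) sp {uI sI} => [|t p IH] y /=; first by move=> _; apply: connect0.
by case/andP=> yt tp; apply: connect_trans (hom _ _ yt) (IH _ tp).
Qed.

(** The map [a] attaches to each leaf [x] a vertex whose closed neighbourhood
    contains [x] and no inner vertex, hence lies in the component of [x] outside
    the inner vertices. *)
Definition witness E (a : V -> V) : Prop :=
  {in leaves E, forall x, [/\ G x (a x), a x \notin inner E
     & forall z, G (a x) z -> z \notin inner E]}.

Definition closed_nb v : {set V} := v |: [set w | G v w].

Lemma witness_outer E a x z : witness E a -> x \in leaves E -> z \in closed_nb (a x) ->
  connect (erel (outer_edges G E)) x z.
Proof.
move=> wa xL; have [xa aI nI] := wa x xL; move: xL; rewrite inE => /eqP dx.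
have xax : connect (erel (outer_edges G E)) x (a x).
  by apply: outer_edge => //; apply: leaf_notin_inner.
rewrite !inE => /orP[/eqP->|az] //.
by apply: connect_trans xax _; apply: outer_edge => //; apply: nI.
Qed.

Lemma leaves_apart_in E x y z :
  conn_sub G E -> 0 < excess E -> ~ improvable G E -> x \in leaves E -> y \in leaves E ->
  connect (erel (outer_edges G E)) x z -> connect (erel (outer_edges G E)) y z -> x = y.
Proof.
move=> cE ex stuck; rewrite !inE => /eqP dx /eqP dy xz yz.
apply/eqP/negPn/negP => xy; have /negP[] := leaves_apart cE ex stuck dx dy xy.
by apply: connect_trans xz _; rewrite outer_csym.
Qed.

(** Let [tau Y] be the set of the leaves [x] such that some vertex of [Y] is adjacent
    to the closed neighbourhood of [a x].  It contains at most [w] when [Y] is [s],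
    by [no_touch].  Adding to [Y] a neighbour [v] of [u] in [Y] adds at most one
    leaf: for two new leaves, [v] would be the centre of a claw formed by [u] and a
    vertex of each closed neighbourhood.  With [Y] the set of all inner vertices,
    every leaf is counted. *)
Lemma leaves_le_inner E s w a :
  claw_free G -> conn_sub G E -> 0 < excess E -> ~ improvable G E ->
  (s, w) \in E -> edeg E w = 1 -> 2 < edeg E s -> witness E a ->
  #|leaves E| <= #|inner E|.
Proof.
move=> claw cE ex stuck sw dw ds wa; have [sE gE' conE] := cE.
pose touch u x := [exists z in closed_nb (a x), G u z].
pose tau (Y : {set V}) := [set x in leaves E | [exists u in Y, touch u x]].
have sI : s \in inner E by rewrite inE ltnW.
suff : #|tau (inner E)| <= #|inner E|.
  apply: leq_trans; apply/subset_leq_card/subsetP => x xL; rewrite inE xL /=.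
  have [xa _ _] := wa x xL; move: (xL); rewrite inE => /eqP dx.
  have /vertsP[t xt] : x \in verts E by rewrite inE dx.
  apply/existsP; exists t; rewrite (leaf_nb_inner cE sI xt) ?leaf_notin_inner //=.
  apply/existsP; exists x; rewrite !inE edge_sym xa orbT /=.
  by rewrite edge_sym; apply: gE'.
apply: (@connected_ind _ E (inner E) s (fun Y => #|tau Y| <= #|Y|)) => //.
- exact: inner_connected.
- rewrite cards1 -(cards1 w); apply/subset_leq_card/subsetP => x.
  rewrite !inE => /andP[/eqP dx /existsP[u]]; rewrite inE => /andP[/eqP-> /existsP[z]].
  case/andP=> zx sz; apply: contraTT sz => xw.
  apply: (no_touch claw cE ex stuck sw dw ds dx xw).
  by apply: witness_outer zx => //; rewrite inE dx.
move=> Y u v PY YI uY vI vY uv.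
rewrite cardsU1 vY addnC; apply: leq_trans (leq_add PY (leqnn _)).
apply: (@leq_trans #|tau Y :|: [set x in leaves E | touch v x && ~~ touch u x]|).
  apply/subset_leq_card/subsetP => x; rewrite !inE.
  case/andP=> -> /existsP[y /andP[]] /setU1P[->|yY] yx /=; last first.
    by apply/orP; left; apply/existsP; exists y; rewrite yY.
  rewrite yx /=; have [ux|//] := boolP (touch u x); rewrite orbC ?orbT //=.
  by apply/existsP; exists u; rewrite uY.
apply: leq_trans (leq_card_setU _ _) _; rewrite leq_add2l leqNgt.
apply/negP => /card_gt1P[x [y []]]; rewrite ![_ \in [set _ in _ | _]]in_set.
move=> /and3P[xL /existsP[z /andP[zx vz]] nux] /and3P[yL /existsP[z' /andP[zy vz']] nuy].
apply/negP; rewrite negbK; apply/eqP.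
have xz := witness_outer wa xL zx; have yz := witness_outer wa yL zy.
have apart := leaves_apart_in cE ex stuck xL yL.
have [dx dy] : edeg E x = 1 /\ edeg E y = 1 by move: xL yL; rewrite !inE => /eqP-> /eqP->.
have [zI z'I] := (outer_notin_inner dx xz, outer_notin_inner dy yz).
have [/eqP zz'|zz'] := boolP (z == z'); first by apply: (apart z) => //; rewrite zz'.
have uI := subsetP YI u uY.
suff zz : G z z'.
  apply: (apart z') => //; apply: connect_trans xz _; exact: outer_edge.
apply: (claw_free_adj (s := v) (a := u)) => //.
- by rewrite edge_sym; apply: gE'.
- by apply: contraNneq zI => <-.
- by apply: contraNneq z'I => <-.
- by apply: contra nux => uz; apply/existsP; exists z; rewrite zx.
- by apply: contra nuy => uz; apply/existsP; exists z'; rewrite zy.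
Qed.

Lemma card_closed_nb v : #|closed_nb v| = (deg G v).+1.
Proof. by rewrite cardsU1 inE edge_irr. Qed.

(** Each vertex lies in at most one of the closed neighbourhoods of the witnesses,
    and in none of them if it is inner. *)
Lemma witness_deg_sum E a A :
  conn_sub G E -> 0 < excess E -> ~ improvable G E -> witness E a -> A \subset leaves E ->
  \sum_(x in A) (deg G (a x)).+1 + #|inner E| <= #|V|.
Proof.
move=> cE ex stuck wa AL.
rewrite (eq_bigr (fun x => \sum_(t : V) (t \in closed_nb (a x) : nat))); last first.
  move=> x _; rewrite -card_closed_nb -sum1_card big_mkcond /=; apply: eq_bigr => t _.
  by case: (_ \in _).
rewrite exchange_big /= -[#|inner E|]sum1_card [X in _ + X]big_mkcond -big_split /=.
rewrite -[#|V|]sum1_card; apply: leq_sum => t _.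
have [/existsP[x /andP[xA tx]]|/existsPn no] := boolP [exists x in A, t \in closed_nb (a x)].
  have xL := subsetP AL x xA; have xt := witness_outer wa xL tx.
  rewrite (negPf (outer_notin_inner _ xt)); last by move: xL; rewrite inE => /eqP.
  rewrite addn0 (bigD1 x) //= big1 ?addn0 ?leq_b1 // => y /andP[yA yx].
  case ty: (_ \in _) => //; case/eqP: yx.
  apply: (leaves_apart_in cE ex stuck _ xL _ xt); first exact: (subsetP AL).
  by apply: witness_outer ty => //; apply: (subsetP AL).
rewrite big1 ?add0n; first by case: ifP.
by move=> x xA; move: (no x); rewrite xA /= => /negPf->.
Qed.

(** The second vertex and the last but one of a path of length two or three
    are in the closed neighbourhoods of its ends. *)
Lemma dist_ge4 x y : x != y ->
  (forall u v, u \in closed_nb x -> v \in closed_nb y -> u != v /\ ~~ G u v) ->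
  ((4%:Z)%:E <= dist G x y)%E.
Proof.
move=> xy far; rewrite /dist.
apply: (big_ind (fun z => ((4%:Z)%:E <= z)%E)) => //.
  by move=> a b ha hb; rewrite minEle; case: ifP.
move=> n /existsP[p /and3P[xp ly _]]; rewrite lee_fin lez_nat leqNgt.
apply/negP => n4; have := size_tuple p; move: n4 xp ly; case: (val p) => /=.
  by move=> _ _; rewrite (negPf xy).
have self v : v \in closed_nb v by rewrite !inE eqxx.
move=> t q n4 /andP[xt tq] lq sq; have sq3 : size q < 3 by rewrite -ltnS sq.
have tx : t \in closed_nb x by rewrite !inE xt orbT.
case: q tq lq sq3 {sq} => [|t' [|y' [|? ?]]] //=.
- move=> _ /eqP E1; have [] := far t y tx (self y); by rewrite E1 eqxx.
- rewrite andbT => tt' /eqP E1 _; have [_] := far t y tx (self y).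
  by rewrite -E1 tt'.
rewrite andbT => /andP[tt' ty] /eqP E1 _.
by have [|_] := far t t' tx; rewrite ?tt' // !inE -E1 edge_sym ty orbT.
Qed.

Lemma witness_dist E a A :
  conn_sub G E -> 0 < excess E -> ~ improvable G E -> witness E a -> A \subset leaves E ->
  {in A &, injective a} /\ dist_set G 4 (a @: A).
Proof.
move=> cE ex stuck wa /subsetP AL.
have self v : v \in closed_nb v by rewrite !inE eqxx.
have injA : {in A &, injective a}.
  move=> x y /AL xL /AL yL axy; apply: (leaves_apart_in cE ex stuck xL yL (z := a x)).
    exact: (witness_outer wa xL (self _)).
  by rewrite axy; apply: (witness_outer wa yL (self _)).
split=> //; apply/forallP => b; apply/implyP => /imsetP[x xA ->].
apply/forallP => c; apply/implyP => /imsetP[y yA ->]; apply/implyP => axy.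
have [xL yL] := (AL _ xA, AL _ yA).
have xNy : x != y by apply: contraNneq axy => ->.
apply: dist_ge4 => // u v ux vy.
have xu := witness_outer wa xL ux; have yv := witness_outer wa yL vy.
have [dx dy] : edeg E x = 1 /\ edeg E y = 1 by move: xL yL; rewrite !inE => /eqP-> /eqP->.
split.
  apply: contraNneq xNy => uv; apply/eqP.
  by apply: (leaves_apart_in cE ex stuck xL yL xu); rewrite uv.
apply: contra xNy => uv; apply/eqP.
apply: (leaves_apart_in cE ex stuck xL yL _ yv).
apply: (connect_trans xu); apply: outer_edge => //.
  exact: outer_notin_inner dx xu.
exact: outer_notin_inner dy yv.
Qed.

End Certificate.

(** * Dominated vertices and private neighbours *)
Lemma subset_of_card (T : finType) (A : {set T}) n :
  n <= #|A| -> exists2 B : {set T}, B \subset A & #|B| = n.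
Proof.
move=> nA; exists [set x in take n (enum A)].
  by apply/subsetP => x; rewrite inE => /mem_take; rewrite mem_enum.
have u : uniq (take n (enum A)) by rewrite take_uniq ?enum_uniq.
by rewrite cardsE (card_uniqP u) size_take -cardE; case: ltngtP nA.
Qed.

Section Extremal.
Variables (V : finType) (G : sgraph V).
Implicit Types (E F : {set V * V}) (A : {set V}) (u v x : V).

(** A boolean form of [conn_sub], needed to choose a maximal subgraph. *)
Definition conn_subb E : bool :=
  [&& [forall u, forall v, ((u, v) \in E) ==> ((v, u) \in E) && G u v]
    & [forall u in verts E, forall v in verts E, connect (erel E) u v]].

Lemma conn_subP E : reflect (conn_sub G E) (conn_subb E).
Proof.
apply: (iffP andP) => [[/forallP sE /forallP cE]|[sE gE cE]].
  have sE' u v : (u, v) \in E -> ((v, u) \in E) && G u v.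
    by move: (sE u) => /forallP/(_ v)/implyP.
  split=> [u v /sE'/andP[]//|u v /sE'/andP[]//|u v uE vE].
  by move: (cE u); rewrite uE /= => /forallP/(_ v); rewrite vE.
split; apply/forallP => u; first by apply/forallP => v; apply/implyP => uv; rewrite sE ?gE.
by apply/implyP => uE; apply/forallP => v; apply/implyP => vE; apply: cE.
Qed.

Definition dominated E : {set V} := [set v | (v \in verts E) || [exists u in verts E, G u v]].

Lemma dominatedP E v : reflect (v \in verts E \/ exists2 u, u \in verts E & G u v) (v \in dominated E).
Proof.
rewrite [v \in dominated E]in_set; apply: (iffP orP).
  by case=> [|/existsP[u /andP[uE uv]]]; [left | right; exists u].
case=> [vE|[u uE uv]]; first by left.
by right; apply/existsP; exists u; rewrite uE.
Qed.

Lemma dominatedS E F : verts E \subset verts F -> dominated E \subset dominated F.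
Proof.
move=> /subsetP EF; apply/subsetP => v /dominatedP[/EF vF|[u /EF uF uv]]; apply/dominatedP.
  by left.
by right; exists u.
Qed.

(** Any path through the leaf [x] enters and leaves it by the same neighbour [t],
    so retracting [x] to [t] keeps the rest connected. *)
Lemma conn_sub_del_leaf E s x : conn_sub G E -> s \in inner E -> edeg E x = 1 ->
  conn_sub G (restrict E (~: [set x])) /\ verts (restrict E (~: [set x])) = verts E :\ x.
Proof.
move=> cE sI dx; have [sE gE' conE] := cE; set R := restrict _ _.
have xE : x \in verts E by rewrite inE dx.
have /vertsP[t xt] := xE.
have xI := leaf_notin_inner dx.
have only y : (x, y) \in E -> y = t.
  by move=> xy; have /card_le1_eqP := eq_leq dx; apply; rewrite inE.
have tI : t \in inner E by apply: (leaf_nb_inner cE sI xt).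
have tx : t != x by apply: contraNneq xI => <-.
have memR u v : (u, v) \in E -> u != x -> v != x -> (u, v) \in R.
  by move=> uv ux vx; rewrite mem_restrict uv !inE ux vx.
have supR : verts R = verts E :\ x.
  apply/eqP; rewrite eqEsubset; apply/andP; split; apply/subsetP => u.
    case/vertsP=> v; rewrite mem_restrict !inE => /and3P[uv ux _].
    by rewrite ux; have := mem_verts uv; rewrite inE.
  rewrite in_setD1 => /andP[ux /vertsP[v uv]]; apply/vertsP.
  have [vx|vx] := eqVneq v x; last by exists v; apply: memR.
  have ut : u = t by apply: only; rewrite -vx; apply: sE.
  move: tI; rewrite -ut inE /edeg (cardsD1 x) inE -vx uv.
  rewrite add1n ltnS => /card_gt0P[y]; rewrite !inE => /andP[yx uy].
  by exists y; apply: memR => //; rewrite -vx.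
split=> //; apply: (@conn_sub_root _ _ _ t).
- move=> u v; rewrite !mem_restrict => /and3P[/sE -> -> ->] //.
- by move=> u v; rewrite mem_restrict => /and3P[/gE'].
pose f y := if y == x then t else y.
have hom y y' : (y, y') \in E -> connect (erel R) (f y) (f y').
  rewrite /f; have [->|yx] := eqVneq y x; have [->|y'x] := eqVneq y' x.
  - by rewrite connect0.
  - by move/only->; rewrite connect0.
  - by move/sE/only->; rewrite connect0.
  - by move=> yy'; apply/connect1/memR.
move=> u; rewrite supR in_setD1 => /andP[ux uE].
have fu : f u = u by rewrite /f (negPf ux).
have ft : f t = t by rewrite /f (negPf tx).
have tE : t \in verts E by apply: mem_verts (sE _ _ xt).
rewrite -fu -ft; case/connectP: (conE t u tE uE) => p tp ->.
elim: p (t) tp {fu ft tx tE tI} => [|z p IH] y /=; first by rewrite connect0.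
by case/andP=> yz zp; apply: connect_trans (hom _ _ yz) (IH _ zp).
Qed.

(** A vertex dominated only thanks to the leaf [x] has no neighbour in [E] but [x];
    it is not [x] itself, which its neighbour in [E] dominates. *)
Lemma private_nb E s x : conn_sub G E -> s \in inner E -> edeg E x = 1 ->
  ~~ (dominated E \subset dominated (restrict E (~: [set x]))) ->
  exists y, [/\ G x y, y \notin verts E & forall z, z \in verts E -> G y z -> z = x].
Proof.
move=> cE sI dx /subsetPn[y yE yR]; have [sE gE' _] := cE.
have [cR supR] := conn_sub_del_leaf cE sI dx.
have xE : x \in verts E by rewrite inE dx.
have [t xt] := vertsP _ _ xE.
have noR u : u \in verts E -> u != x -> ~~ G u y.
  move=> uE ux; apply: contra yR => uy; apply/dominatedP; right; exists u => //.
  by rewrite supR in_setD1 ux.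
have yS : y \notin verts E.
  apply/negP => ys; have [yx|yx] := eqVneq y x; last first.
    by move/negP: yR; apply; apply/dominatedP; left; rewrite supR in_setD1 yx.
  have xNt : t != x.
    by apply: contraTneq (gE' _ _ xt) => ->; rewrite edge_irr.
  have /negP[] := noR t (mem_verts (sE _ _ xt)) xNt.
  by rewrite yx; apply/gE'/sE.
have only z : z \in verts E -> G y z -> z = x.
  move=> zE yz; apply/eqP; apply: contraTT yz => zx.
  by rewrite edge_sym; apply: noR.
exists y; split=> //; case/dominatedP: yE => [ys|[u uE uy]]; first by rewrite ys in yS.
by rewrite -(only u) // edge_sym.
Qed.

Lemma edeg_pend E a b : conn_sub G E -> b \notin verts E -> a != b ->
  edeg (add_edge E a b) a = (edeg E a).+1 /\ edeg (add_edge E a b) b = 1.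
Proof.
move=> [sE _ _] bE ab.
have nbb t : (b, t) \in E = false by apply: contraNF bE => /mem_verts.
split.
  rewrite /edeg (_ : nb _ a = b |: nb E a).
    rewrite cardsU1 inE (_ : (a, b) \in E = false) //.
    by apply: contraFF (nbb a) => /sE.
  by apply/setP => t; rewrite !inE !xpair_eqE eqxx (negPf ab).
rewrite /edeg (_ : nb _ b = [set a]) ?cards1 //.
apply/setP => t; rewrite in_set mem_add_edge in_set1 eqxx eq_sym (negPf ab) /=.
by rewrite nbb orbF.
Qed.

End Extremal.

(** * The extremal subgraph *)
Section Main.
Variables (V : finType) (G : sgraph V).
Implicit Types (E F : {set V * V}) (A : {set V}) (u v x : V).

Lemma excess_pend E a b : conn_sub G E -> b \notin verts E -> a != b ->
  excess (add_edge E a b) <= excess E + (1 < edeg E a).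
Proof.
move=> cE bE ab; have [da db] := edeg_pend cE bE ab.
rewrite /excess (bigD1 a) //= [X in _ <= X + _](bigD1 a) //= da addnAC.
apply: leq_add; first by clear; case: (edeg E a) => [|[|n]] //=; lia.
apply: leq_sum => u ua; have [->|ub] := eqVneq u b; first by rewrite db.
by rewrite edeg_add_out.
Qed.

(** Lexicographic order: more dominated vertices first, then fewer vertices. *)
Definition weight E := #|dominated G E| * #|V|.+1 + (#|V| - #|verts E|).

Lemma weight_dominated E F : #|dominated G E| < #|dominated G F| -> weight E < weight F.
Proof.
move=> EF; rewrite /weight.
apply: (@leq_trans ((#|dominated G E|).+1 * #|V|.+1)).
  by rewrite mulSn addnC ltn_add2r ltnS leq_subr.
by rewrite (leq_trans _ (leq_addr _ _)) // leq_mul2r EF orbT.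
Qed.

Lemma weight_verts E F : #|dominated G E| <= #|dominated G F| -> #|verts F| < #|verts E| ->
  weight E < weight F.
Proof.
move=> EF sFE; rewrite /weight -addnS leq_add ?leq_mul2r ?EF ?orbT //.
by apply: ltn_sub2l => //; apply: leq_trans sFE (max_card _).
Qed.

(** On a path from [E] to an undominated vertex, take the first edge [w v] that
    leaves the dominated set. *)
Lemma undominated E : connected G -> 0 < #|verts E| -> dominated G E != setT ->
  exists s w v, [/\ s \in verts E, w \notin verts E, v \notin dominated G E, G s w & G w v].
Proof.
move=> [_ conG] /card_gt0P[r rE]; rewrite -subTset => /subsetPn[t _ tE].
have rD : r \in dominated G E by apply/dominatedP; left.
suff [w [v [wD vD wv]]] : exists w v, [/\ w \in dominated G E, v \notin dominated G E & G w v].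
  have wE : w \notin verts E.
    by apply: contra vD => wE; apply/dominatedP; right; exists w.
  by case/dominatedP: wD => [|[s sE sw]]; [rewrite (negPf wE) | exists s, w, v].
have /connectP[p] := conG r t; elim: p (r) rD => [|y p IH] u uD /=.
  by move=> _ E1; rewrite E1 uD in tE.
case/andP=> uy yp lp; have [yD|yD] := boolP (y \in dominated G E); first exact: IH lp.
by exists u, y.
Qed.

(** If some vertex were not dominated, the witnesses of [k + 3] leaves of [E]
    extended by one pendant edge would violate the hypothesis on degree sums. *)
Lemma extremal_dominating E k :
  claw_free G -> connected G -> conn_sub G E -> 0 < #|verts E| -> excess E <= k ->
  #|E| + 2 <= 2 * #|verts E| ->
  (forall F, conn_sub G F -> 0 < #|verts F| -> excess F <= k -> weight F <= weight E) ->
  (forall S : {set V}, #|S| = k + 3 -> dist_set G 4 S ->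
     #|V| < \sum_(a in S) (deg G a).+1 + (k + 3)) ->
  dominated G E = setT.
Proof.
move=> claw conG cE E0 exE spE maxE degE; apply/eqP/negPn/negP => nD.
have [s [w [v [sE wE vD sw wv]]]] := undominated conG E0 nD.
have [symE gE' conE] := cE.
have sNw : s != w by apply: contraNneq wE => <-.
have [dgs dgw] := edeg_pend cE wE sNw.
pose P := add_edge E s w.
have cP : conn_sub G P by apply: conn_sub_pend.
have sP : verts P = w |: verts E.
  by rewrite /P verts_add setUCA (setUidPr (_ : [set s] \subset verts E)) ?sub1set.
(* Such an [F] dominates [v] as well, so its excess must exceed [k]. *)
have big F : conn_sub G F -> verts P \subset verts F -> k < excess F.
  move=> cF PF; rewrite ltnNge; apply/negP => exF.
  have sEF : verts E \subset verts F.
    by apply: subset_trans PF; rewrite sP subsetUr.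
  have lt : #|dominated G E| < #|dominated G F|.
    apply: proper_card; apply/properP; split; first exact: dominatedS.
    exists v => //; apply/dominatedP; right; exists w => //.
    by apply: (subsetP PF); rewrite sP setU11.
  have F0 : 0 < #|verts F| by apply: leq_trans E0 (subset_leq_card sEF).
  by have := weight_dominated lt; rewrite ltnNge maxE.
have exP := big P cP (subxx _).
(* A pendant edge at a leaf would not raise the excess. *)
have ds : 1 < edeg E s.
  rewrite ltnNge; apply/negP => ds.
  have := excess_pend cE wE sNw; rewrite ltnNge ds addn0 leqNgt => /negP; apply.
  exact: leq_ltn_trans exP.
have exP' : excess P <= k.+1.
  apply: leq_trans (excess_pend cE wE sNw) _.
  by rewrite ds addn1 ltnS.
have stuck : ~ improvable G P.
  by case=> F [cF PF ltF]; have := big F cF PF; lia.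
have sI : s \in inner E by rewrite inE.
have leafE x : x \in leaves P -> x != w -> edeg E x = 1.
  rewrite inE => dx xw; have [xs|xs] := eqVneq x s.
    by move: dx; rewrite xs dgs => /eqP[dx]; move: ds; rewrite dx.
  by move: dx; rewrite edeg_add_out // => /eqP.
have innE z : z \in inner P -> z \in verts E.
  move=> zI; have : z \in verts P by move: zI; rewrite !inE => /ltnW.
  by rewrite sP in_setU1 => /orP[/eqP zw|//]; move: zI; rewrite zw inE dgw.
have priv x : x \in leaves P -> x != w ->
    exists y, [/\ G x y, y \notin verts E & forall z, z \in verts E -> G y z -> z = x].
  move=> xL xw; have dx := leafE x xL xw; apply: (private_nb cE sI dx).
  have [cR sR] := conn_sub_del_leaf cE sI dx; apply/negP => domR.
  have xE : x \in verts E by rewrite inE dx.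
  have ltR : #|verts (restrict E (~: [set x]))| < #|verts E|.
    by rewrite sR [X in _ < X](cardsD1 x) xE.
  have := weight_verts (subset_leq_card domR) ltR; rewrite ltnNge maxE //.
    rewrite sR; apply/card_gt0P; exists s; rewrite in_setD1 sE andbT.
    by apply: contraTneq ds => ->; rewrite dx.
  apply: leq_trans exE; apply: excess_le => u; apply: leq_sub2r.
  exact/edegS/restrict_sub.
pose good x y := [&& G x y, y \notin verts E & [forall z in verts E, G y z ==> (z == x)]].
pose a x := if x == w then v else odflt x [pick y | good x y].
have wa : witness G P a.
  move=> x xL; rewrite /a; have [xw|xw] := eqVneq x w.
    rewrite xw wv; split=> //.
      by apply: contra vD => vI; apply/dominatedP; left; apply: innE.
    move=> z vz; apply: contra vD => zI; apply/dominatedP; right; exists z; first exact: innE.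
    by rewrite edge_sym.
  have [y0 [xy0 y0E y0u]] := priv x xL xw.
  case: pickP => [y|/(_ y0)] /=; last first.
    rewrite /good xy0 y0E /= => /negP[]; apply/forallP => z; apply/implyP => zE.
    by apply/implyP => yz; apply/eqP/y0u.
  case/and3P=> xy yE /forallP yu; split=> //.
    by apply: contra yE; apply: innE.
  move=> z yz; apply/negP => zI; move: (yu z); rewrite (innE _ zI) yz /= => /eqP zx.
  by move: xL zI; rewrite zx !inE => /eqP->.
have exP0 : 0 < excess P by apply: leq_ltn_trans exP.
have swP : (s, w) \in P by apply: add_edge_mem1.
have dsP : 2 < edeg P s by rewrite dgs.
have le_in := leaves_le_inner claw cP exP0 stuck swP dgw dsP wa.
(* [E] is sparse, and [P] has one more vertex and two more ordered pairs. *)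
have leL : k + 3 <= #|leaves P|.
  have := excess_leaves P; rewrite sP cardsU1 wE.
  have : #|P| <= #|E| + 2.
    rewrite /P /add_edge !cardsU1 addnA addnC leq_add2l.
    by case: (_ \notin _); case: (_ \notin _).
  by move: exP spE; clear; lia.
have [A AL cA] := subset_of_card leL.
have [inj dS] := witness_dist cP exP0 stuck wa AL.
have cS : #|a @: A| = k + 3 by rewrite card_in_imset.
have := witness_deg_sum cP exP0 stuck wa AL.
have := degE _ cS dS; rewrite big_imset //=.
move: leL le_in; clear; lia.
Qed.

(** Hang every vertex outside [E] on a vertex of [E] and take a spanning tree: the
    hung vertices are leaves, so its stem lies inside [E]. *)
Lemma spanning_tree_of_dominating E : connected G -> conn_sub G E -> 0 < #|verts E| ->
  dominated G E = setT ->
  exists T : sgraph V, spanning_tree G T /\ #|branch (Stem T)| <= excess E.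
Proof.
move=> conG cE /card_gt0P[r rE] domE; have [sE gE' conE] := cE.
pose f v := odflt v [pick u | (u \in verts E) && G u v].
have fP v : v \notin verts E -> f v \in verts E /\ G (f v) v.
  move=> vE; have : v \in dominated G E by rewrite domE inE.
  rewrite /f; case: pickP => [u /andP[]//|none].
  by case/dominatedP=> [|[u uE uv]]; [rewrite (negPf vE) | have := none u; rewrite uE uv].
pose F := [set e : V * V | [|| e \in E,
  (e.1 \notin verts E) && (e.2 == f e.1) | (e.2 \notin verts E) && (e.1 == f e.2)]].
have memF u v : ((u, v) \in F) = [|| (u, v) \in E,
  (u \notin verts E) && (v == f u) | (v \notin verts E) && (u == f v)].
  by rewrite in_set.
have symF u v : (u, v) \in F -> (v, u) \in F.
  by rewrite !memF => /or3P[/sE->|->|->]; rewrite ?orbT.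
have EF : E \subset F by apply/subsetP => e; rewrite inE => ->.
have pend v : v \notin verts E -> (f v, v) \in F by move=> vE; rewrite memF vE eqxx !orbT.
have rF u : connect (erel F) r u.
  have [uE|uE] := boolP (u \in verts E); first exact/(connectS EF)/conE.
  have [fE fu] := fP u uE; apply: connect_trans (connect1 (pend u uE)).
  exact/(connectS EF)/conE.
have cF : conn_sub G F.
  apply: (@conn_sub_root _ _ _ r) => // u v; rewrite memF => /or3P[/gE'//||].
    by case/andP=> uE /eqP->; rewrite edge_sym; apply: (fP u uE).2.
  by case/andP=> vE /eqP->; apply: (fP v vE).2.
have rF' : r \in verts F by apply: (subsetP (vertsS EF)).
have [T [TF cT sT _ aT]] := sparse_tree cF rF'; have [symT gT conT] := cT.
have suppF u : u \in verts F.
  have [uE|uE] := boolP (u \in verts E); first exact: (subsetP (vertsS EF)).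
  by apply: mem_verts (symF _ _ (pend u uE)).
have irrT : irreflexive (erel T).
  by move=> u; apply/negP => /gT; rewrite edge_irr.
have symT' : symmetric (erel T) by move=> u v; apply/idP/idP; apply: symT.
pose H := SGraph symT' irrT; exists H; split.
  split; last by move=> u v; apply: gT.
  split; last exact: aT.
  by split; [exact: conG.1 | move=> u v; apply: conT; rewrite sT].
have leafH v : v \notin verts E -> v \in Leaf H.
  move=> vE; rewrite inE; apply/eqP/eqP; rewrite eqn_leq; apply/andP; split.
    rewrite -(cards1 (f v)); apply/subset_leq_card/subsetP => u; rewrite in_set.
    move/(subsetP TF); rewrite memF vE /= => /or3P[/mem_verts|/eqP->|].
    - by rewrite (negPf vE).
    - by rewrite in_set1.
    - by case/andP=> uE /eqP E1; move: vE; rewrite E1 (fP u uE).1.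
  by have := suppF v; rewrite -sT inE.
have stemE (x : {x : V | x \in ~: Leaf H}) : val x \in verts E.
  by apply: contraTT (valP x) => /leafH; rewrite in_setC negbK.
apply: leq_trans (card_branch_le E).
rewrite -(card_imset _ val_inj); apply/subset_leq_card/subsetP => _ /imsetP[x xB ->].
rewrite inE; move: xB; rewrite inE => /leq_trans; apply.
rewrite /deg -(card_imset _ val_inj); apply/subset_leq_card/subsetP => _ /imsetP[y xy ->].
rewrite inE; move: xy; rewrite inE => /(subsetP TF); rewrite memF !stemE /=.
by rewrite !orbF.
Qed.

End Main.

(** * The theorem *)

(** A set as in the definition of sigma has [k + 3] members, so a degree sum of at
    least [|V| - 2 k - 5] says that fewer than [k + 3] vertices lie outside its
    closed neighbourhoods. *)
Theorem theorem1p8 (V : finType) (G : sgraph V) (k : nat) :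
  connected G -> claw_free G ->
  ((#|V|%:Z - 2 * k%:Z - 5)%R%:E <= sigma G 4 (k + 3))%E ->
  exists T : sgraph V, spanning_tree G T /\ #|branch (Stem T)| <= k.
Proof.
move=> conG claw sig; have [V0 cG] := conG.
(* With one vertex there is no edge to start from, and [G] is itself the tree. *)
have [V1|V2] := leqP #|V| 1.
  exists G; split.
    split=> //; split=> // c /andP[_ /card_uniqP cc].
    by rewrite -cc (leq_ltn_trans (max_card _)) // (leq_ltn_trans V1).
  rewrite (_ : branch _ = set0) ?cards0 //; apply/setP => x; rewrite !inE.
  apply/negbTE; rewrite -ltnNge ltnS (leq_trans (max_card _)) // card_sig.
  by apply: leq_trans (max_card _) _; apply: leqW.
have degE (S : {set V}) : #|S| = k + 3 -> dist_set G 4 S ->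
     #|V| < \sum_(a in S) (deg G a).+1 + (k + 3).
  move=> cS dS; move: sig; rewrite /sigma ltnNge.
  rewrite (_ : k + 3 <= alpha G 4) /=; last first.
    by rewrite -cS; apply: (@leq_bigmax_cond _ (dist_set G 4) (fun S : {set V} => #|S|)).
  move=> sig; have : ((#|V|%:Z - 2 * k%:Z - 5)%R%:E <=
      ((\sum_(a in S) deg G a)%N%:Z)%:E)%E.
    apply: (le_trans sig); apply: bigmin_le_cond.
    by rewrite cS eqxx.
  have -> : \sum_(a in S) (deg G a).+1 = \sum_(a in S) deg G a + #|S|.
    by rewrite -sum1_card -big_split /=; apply: eq_bigr => a _; rewrite addn1.
  rewrite lee_fin cS; move: (\sum_(a in S) deg G a) #|V| => D n.
  by clear; lia.
(* A single edge, which starts the search for an extremal subgraph. *)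
have [E0 [cE0 sE0 exE0]] : exists E, [/\ conn_sub G E, 0 < #|verts E| & excess E = 0].
  move/card_gt1P: V2 => [r [t [_ _ rt]]].
  have /connectP[[|b p]] := cG r t; first by move=> _ E1; rewrite E1 eqxx in rt.
  case/andP=> rb _ _; exists (add_edge set0 r b).
  have s0 : verts (add_edge set0 r b) = [set r; b].
    rewrite verts_add; apply/setP => u; rewrite !inE.
    by rewrite (_ : edeg set0 u = 0) ?orbF //; apply: eq_card0 => z; rewrite !inE.
  split.
  - apply: (@conn_sub_root _ _ _ r) => [u v|u v|u].
    + by apply: add_edge_sym => ? ?; rewrite inE.
    + by apply: add_edge_subgraph => // ? ?; rewrite inE.
    + rewrite s0 => /set2P[]->; first exact: connect0.
      exact/connect1/add_edge_mem1.
  - by rewrite s0 cards2.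
  - apply: big1 => u _; apply/eqP; rewrite subn_eq0.
    apply: leq_trans (edeg_add_le _ _ _ _) _.
    rewrite (_ : edeg set0 u = 0) ?add0n; last by apply: eq_card0 => z; rewrite !inE.
    by case: (u == r); case: (u == b).
pose good (E : {set V * V}) := [&& conn_subb G E, 0 < #|verts E| & excess E <= k].
have good0 : good E0 by rewrite /good sE0 exE0 andbT; apply/conn_subP.
case: (arg_maxnP (weight G) good0) => E /and3P[/conn_subP cE sE exE] maxE.
have /card_gt0P[r rE] := sE.
have [T [TE cT sT nT _]] := sparse_tree cE rE.
have exT : excess T <= k.
  by apply: leq_trans exE; apply: excess_le => u; apply/leq_sub2r/edegS.
have wT : weight G T = weight G E.
  by rewrite /weight /dominated sT.
have sT0 : 0 < #|verts T| by rewrite sT.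
have domT : dominated G T = setT.
  apply: (extremal_dominating claw conG cT sT0 exT _ _ degE); first by rewrite sT.
  move=> F cF F0 exF; rewrite wT; apply: maxE.
  by rewrite /good F0 exF !andbT; apply/conn_subP.
have [H [spH brH]] := spanning_tree_of_dominating conG cT sT0 domT.
by exists H; split=> //; apply: leq_trans exT.
Qed.
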